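(* Let $\mathbf{T}=(T_1,\dots,T_d)\in\mathfrak{B}(\mathcal{H})^d$. Then for each $0\le\lambda\le1$, $$2\sqrt{\lambda-\lambda^2}\,\|\widetilde{\mathbf{T}}\|_h\le\|\mathbf{M}_\lambda(\mathbf{T})\|_h\le\lambda\|\mathbf{T}\|_h+(1-\lambda)\|\mathbf{T}^D\|_h\le\|\mathbf{T}\|.$$ In particular, for $\lambda=\frac12$, $\|\widetilde{\mathbf{T}}\|_h\le\|\widehat{\mathbf{T}}\|_h\le\|\mathbf{T}\|$.
   Context: $\mathcal{H}$ is a separable complex Hilbert space, $\mathfrak{B}(\mathcal{H})$ the bounded linear operators on $\mathcal{H}$, and $d\in\mathbb{N}$. For $\mathbf{T}=(T_1,\dots,T_d)\in\mathfrak{B}(\mathcal{H})^d$, the spherical (joint) operator norm is $\|\mathbf{T}\|=\sup\{(\sum_{k=1}^d\|T_kx\|^2)^{1/2}: x\in\mathcal{H},\ \|x\|=1\}$, and the hypo-norm is $\|\mathbf{T}\|_h=\sup\|\lambda_1T_1+\cdots+\lambda_dT_d\|$ over all $(\lambda_1,\dots,\lambda_d)\in\mathbb{C}^d$ with $\sum_k|\lambda_k|^2\le1$. Canonical spherical polar decomposition: $\mathbf{T}=\mathbf{V}P=(V_1P,\dots,V_dP)$, where $P=\sqrt{T_1^*T_1+\cdots+T_d^*T_d}$ and $\mathbf{V}=(V_1,\dots,V_d)$, viewed as a column operator $\mathcal{H}\to\mathcal{H}^d$, is the partial isometry with initial space $\mathcal{N}(P)^\perp$; that is, $T_i=V_iP$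 for all $i$ and $\sum_{i=1}^dV_i^*V_i$ is the orthogonal projection onto $\mathcal{N}(P)^\perp=\overline{\mathcal{R}(P)}$. The spherical Aluthge transform is $\widetilde{\mathbf{T}}=(P^{1/2}V_1P^{1/2},\dots,P^{1/2}V_dP^{1/2})$; the spherical Duggal transform is $\mathbf{T}^D=(PV_1,\dots,PV_d)$; the spherical mean transform is $\widehat{\mathbf{T}}=\frac12(\mathbf{T}+\mathbf{T}^D)$; for $\lambda\in[0,1]$ the spherical $\lambda$-mean transform is $\mathbf{M}_\lambda(\mathbf{T})=\lambda\mathbf{T}+(1-\lambda)\mathbf{T}^D$ (coordinatewise operations). *)

(* Defs.v *)
From HB Require Import structures.
From mathcomp Require Import all_boot all_order all_algebra.
From mathcomp Require Import sesquilinear.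
From mathcomp Require Import complex.
From mathcomp Require Import all_classical all_reals all_analysis.

Set Implicit Arguments.
Unset Strict Implicit.
Unset Printing Implicit Defensive.

Import Order.TTheory GRing.Theory Num.Theory Num.Def.
Import numFieldNormedType.Exports.

Local Open Scope classical_set_scope.
Local Open Scope ring_scope.
Local Open Scope complex_scope.

(* A complex Hilbert space is a complete normed space over R[i] whose norm is
   the one of an inner product [dot], linear in its first argument and
   conjugate-linear in its second. *)
Definition norm_of_dot (R : realType) (H : completeNormedModType R[i])
    (dot : {dot H for (@conjC R[i])}) : Prop :=
  forall x : H, `|x| ^+ 2 = dot x x.

Definition separable_space (H : topologicalType) : Prop :=
  exists2 S : set H, countable S & dense S.

Section Operators.
Context {R : realType} {H : completeNormedModType R[i]}.
Implicit Types A B : H -> H.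

Definition bounded_op A : Prop :=
  linear A /\ exists M : R[i], forall x, `|A x| <= M * `|x|.

(* [`|x|] lives in R[i]; suprema are taken in R. *)
Definition rnorm (x : H) : R := complex.Re `|x|.

Definition op_norm A : R :=
  sup [set rnorm (A x) | x in [set x | rnorm x = 1]].

Context {d : nat}.
Implicit Types T : 'I_d -> H -> H.

Definition joint_norm T : R :=
  sup [set sqrtr (\sum_(k < d) rnorm (T k x) ^+ 2) | x in [set x | rnorm x = 1]].

Definition hypo_norm T : R :=
  sup [set op_norm (\sum_(k < d) l k \*: T k) |
       l in [set l : 'I_d -> R[i] | \sum_(k < d) `|l k| ^+ 2 <= 1]].

End Operators.

Section Transforms.
Context {R : realType} {H : completeNormedModType R[i]}.
Context (dot : {dot H for (@conjC R[i])}).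
Implicit Types A B E : H -> H.

(* The adjoint, the positive square root and the polar factor below are
   selected by their defining properties, which determine them uniquely;
   [xget] returns its default only if no object has these properties. *)

Definition adjoint A : H -> H :=
  xget (0 : H -> H)
    [set B | bounded_op B /\ forall x y, dot (A x) y = dot x (B y)].

(* In R[i], [0 <= z] says that z is real and nonnegative. *)
Definition positive_op A : Prop := forall x, 0 <= dot (A x) x.

Definition sqrt_op A : H -> H :=
  xget (0 : H -> H)
    [set B | [/\ bounded_op B, positive_op B & B \o B = A]].

Definition op_kernel A : set H := [set x | A x = 0].

Definition orthogonal_complement (M : set H) : set H :=
  [set x | forall y, M y -> dot x y = 0].

Definition orthogonal_projection_onto (M : set H) E : Prop :=
  forall x, M (E x) /\ orthogonal_complement M (x - E x).

Context {d : nat}.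
Implicit Types T V : 'I_d -> H -> H.

Definition polar_modulus T : H -> H :=
  sqrt_op (\sum_(k < d) (adjoint (T k) \o T k)).

Definition is_polar_factor T V : Prop :=
  [/\ forall k, bounded_op (V k),
      forall k, T k = V k \o polar_modulus T &
      orthogonal_projection_onto
        (orthogonal_complement (op_kernel (polar_modulus T)))
        (\sum_(k < d) (adjoint (V k) \o V k))].

Definition polar_factor T : 'I_d -> H -> H :=
  xget (fun=> 0) [set V | is_polar_factor T V].

Definition aluthge T : 'I_d -> H -> H :=
  let Q := sqrt_op (polar_modulus T) in
  fun k => Q \o polar_factor T k \o Q.

Definition duggal T : 'I_d -> H -> H :=
  fun k => polar_modulus T \o polar_factor T k.

Definition mean_transform T : 'I_d -> H -> H :=
  fun k => 2^-1 \*: (T k \+ duggal T k).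

Definition lambda_mean (l : R) T : 'I_d -> H -> H :=
  fun k => (l%:C \*: T k) \+ ((1 - l)%:C \*: duggal T k).

End Transforms.

(* Main.v *)
Require Import Defs.
From mathcomp Require Import all_boot all_order all_algebra.
From mathcomp Require Import sesquilinear.
From mathcomp Require Import complex.
From mathcomp Require Import ring lra.
From mathcomp Require Import all_classical all_reals all_analysis.
Import Order.TTheory GRing.Theory Num.Theory Num.Def.
Import numFieldNormedType.Exports.
Local Open Scope ring_scope.

Set Implicit Arguments.
Unset Strict Implicit.
Unset Printing Implicit Defensive.

(** For coefficients [m] in the unit ball, put [A = sum_k m_k V_k].  With
    [Q^2 = P] the three tuples combine to
    - [Q A Q] for the Aluthge transform,
    - [l A Q^2 + (1 - l) Q^2 A] for the [l]-mean transform,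
    - [P A] for the Duggal transform.

    The first inequality is thus an instance of the arithmetic-geometric mean
    inequality [2 ||X A Y|| <= ||X^2 A + A Y^2||] for self-adjoint [X] and [Y]
    ([op_norm_agm]), taken at [X = sqrt (1 - l) Q] and [Y = sqrt l Q].  It is
    proved with approximate singular vectors: if [B = X A Y] had norm
    [b > ||X^2 A + A Y^2|| / 2], take a unit vector [u] that almost attains
    [b], so that [B u = b v] and [B^* v] is close to [b u].  For [w = Y u] and
    [z = X v], the form [<(X^2 A + A Y^2) w, z>] is close to
    [b (||w||^2 + ||z||^2)], whereas it is at most
    [||X^2 A + A Y^2|| (||w||^2 + ||z||^2) / 2]; and [w], [z] stay away from
    zero because [<A w, z> = <B u, v>] is about [b].

    The second inequality is the triangle inequality.  The third one bounds
    both hypo-norms by the joint norm: for [T] this is the Cauchy-Schwarz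
    inequality in the index [k]; for [T^D] it combines
    [||P x||^2 = sum_k ||T_k x||^2 <= ||T||^2 ||x||^2] with
    [||A x||^2 <= sum_k ||V_k x||^2 <= ||x||^2], the sum of the [V_k^* V_k]
    being a projection.

    Adjoints come from the Riesz representation theorem ([Riesz_real]).  Most
    computations use the real inner product [Re <x, y>], which determines the
    complex one; self-adjointness, adjoints and Cauchy-Schwarz can all be
    phrased with it.  The square roots and the polar factor are given by a
    selection with default value [0]; [sqrt_opP] and [polar_factorP] state what
    holds for either outcome, and a default [Q] or [V] makes the Aluthge
    transform zero. *)

(** * The norm as a real number and the real part of the inner product *)

Section RealInnerProduct.
Local Open Scope complex_scope.
Context {R : realType} {H : completeNormedModType R[i]}.
Implicit Types (x y z : H) (a : R[i]) (c : R).

Lemma norm_rnorm x : `|x| = (rnorm x)%:C.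
Proof. by rewrite /rnorm RRe_real// normr_real. Qed.

Lemma rnorm_ge0 x : 0 <= rnorm x.
Proof. by rewrite -lecR -norm_rnorm normr_ge0. Qed.

Lemma rnorm0 : rnorm (0 : H) = 0.
Proof. by rewrite /rnorm normr0. Qed.

Lemma rnorm_eq0 x : rnorm x = 0 -> x = 0.
Proof. by move=> x0; apply/eqP; rewrite -normr_eq0 norm_rnorm x0. Qed.

Lemma rnormD x y : rnorm (x + y) <= rnorm x + rnorm y.
Proof. by rewrite -lecR rmorphD/= -!norm_rnorm ler_normD. Qed.

Lemma Re_norm_ge0 a : 0 <= complex.Re `|a|.
Proof. by rewrite normc_def sqrtr_ge0. Qed.

Lemma rnormZ a x : rnorm (a *: x) = complex.Re `|a| * rnorm x.
Proof.
by apply: complexI; rewrite -norm_rnorm normrZ rmorphM/= -!norm_rnorm.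
Qed.

Lemma rnormZr c x : rnorm (c%:C *: x) = `|c| * rnorm x.
Proof. by rewrite rnormZ normc_def/= expr0n addr0 sqrtr_sqr. Qed.

Context (dot : {dot H for (@conjC R[i])}).

Definition rdot x y : R := complex.Re (dot x y).

Lemma rdotDl x y z : rdot (x + y) z = rdot x z + rdot y z.
Proof. by rewrite /rdot linearDl raddfD. Qed.

Lemma dotZr a x y : dot x (a *: y) = a^* * dot x y.
Proof. by rewrite linearZr_LR. Qed.

Lemma dotZl a x y : dot (a *: x) y = a * dot x y.
Proof. by rewrite linearZl_LR. Qed.

Lemma dotC x y : dot x y = (dot y x)^*.
Proof. by rewrite hermC expr0 mul1r. Qed.

Lemma rdotC x y : rdot x y = rdot y x.
Proof. by rewrite /rdot dotC; case: (dot y x). Qed.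

Lemma rdotDr x y z : rdot x (y + z) = rdot x y + rdot x z.
Proof. by rewrite rdotC rdotDl !(rdotC x). Qed.

Lemma rdotZl c x y : rdot (c%:C *: x) y = c * rdot x y.
Proof. by rewrite /rdot dotZl; case: (dot x y) => u v /=; rewrite mul0r subr0. Qed.

Lemma rdotZr c x y : rdot x (c%:C *: y) = c * rdot x y.
Proof. by rewrite rdotC rdotZl rdotC. Qed.

(** Recovers the imaginary part of the inner product from the real one. *)
Lemma rdotil x y : rdot ('i *: x) y = - complex.Im (dot x y).
Proof. by rewrite /rdot dotZl; case: (dot x y) => u v /=; rewrite mul0r mul1r sub0r. Qed.

Lemma rdotNl x y : rdot (- x) y = - rdot x y.
Proof. by rewrite /rdot linearNl raddfN. Qed.

Lemma rdotNr x y : rdot x (- y) = - rdot x y.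
Proof. by rewrite rdotC rdotNl rdotC. Qed.

Context (hdot : norm_of_dot dot).

Lemma rdotxx x : rdot x x = rnorm x ^+ 2.
Proof. by rewrite /rdot -hdot norm_rnorm -rmorphXn. Qed.

Lemma rnormD_sqr x y :
  rnorm (x + y) ^+ 2 = rnorm x ^+ 2 + 2 * rdot x y + rnorm y ^+ 2.
Proof. rewrite -!rdotxx rdotDl !rdotDr (rdotC y x); ring. Qed.

Lemma CauchySchwarz_rdot x y : `|rdot x y| <= rnorm x * rnorm y.
Proof.
have [y0|y0] := eqVneq (rnorm y) 0.
  have := rnorm_eq0 y0 => ->; rewrite rnorm0 mulr0.
  by rewrite /rdot linear0r normr0.
have yp : 0 < rnorm y by rewrite lt_neqAle eq_sym y0 rnorm_ge0.
rewrite -(@ler_pXn2r _ 2) ?nnegrE ?mulr_ge0 ?rnorm_ge0// real_normK ?num_real//.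
(* [x - t *: y] is the component of [x] orthogonal to [y] over the reals. *)
set p := rdot x y; set t := p / rnorm y ^+ 2.
have := sqr_ge0 (rnorm (x + (- t)%:C *: y)).
rewrite rnormD_sqr rdotZr rnormZr normrN exprMn real_normK ?num_real// -/p.
have -> : rnorm x ^+ 2 + 2 * (- t * p) + t ^+ 2 * rnorm y ^+ 2
   = rnorm x ^+ 2 - p ^+ 2 / rnorm y ^+ 2 by rewrite /t; field.
by rewrite subr_ge0 ler_pdivrMr ?exprn_gt0// exprMn.
Qed.
End RealInnerProduct.

(** * Operator norm, joint norm and hypo-norm *)

Section FiniteCauchySchwarz.
Context {R : realType} {d : nat}.

Lemma sum_mul_le_sqrt (m a : 'I_d -> R) :
  \sum_k m k ^+ 2 <= 1 -> \sum_k m k * a k <= sqrtr (\sum_k a k ^+ 2).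
Proof.
move=> m1; set S := \sum_k a k ^+ 2.
have S0 : 0 <= S by apply: sumr_ge0 => k _; exact: sqr_ge0.
have [Sz|Sn0] := eqVneq S 0.
  rewrite Sz sqrtr0 big1// => k _.
  move/eqP : Sz; rewrite psumr_eq0; last by move=> ? _; exact: sqr_ge0.
  by move=> /allP/(_ k (mem_index_enum _)); rewrite sqrf_eq0 => /eqP ->; rewrite mulr0.
have s0 : 0 < sqrtr S by rewrite sqrtr_gt0 lt_neqAle eq_sym Sn0.
set s := sqrtr S in s0 *.
have sS : S = s ^+ 2 by rewrite sqr_sqrtr.
(* Termwise [2 m a <= s m^2 + a^2 / s], balanced so that both sums give [s]. *)
apply: (@le_trans _ _ (\sum_k (s / 2 * m k ^+ 2 + (2 * s)^-1 * a k ^+ 2))).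
  apply: ler_sum => k _; rewrite -subr_ge0.
  have -> : s / 2 * m k ^+ 2 + (2 * s)^-1 * a k ^+ 2 - m k * a k
    = (2 * s)^-1 * (s * m k - a k) ^+ 2 by field; lra.
  by rewrite mulr_ge0 ?sqr_ge0// invr_ge0; lra.
rewrite big_split/= -!mulr_sumr -/S sS.
have -> : (2 * s)^-1 * s ^+ 2 = s / 2 by field; lra.
have : s / 2 * (\sum_i m i ^+ 2) <= s / 2 * 1 by rewrite ler_pM2l// divr_gt0.
by lra.
Qed.
End FiniteCauchySchwarz.

Section OperatorNorm.
Local Open Scope complex_scope.
Context {R : realType} {H : completeNormedModType R[i]}.
Implicit Types (A B : H -> H) (x : H).

(** The complex bound of [bounded_op] can be replaced by a nonnegative real
    one: if [H] has a nonzero vector, its real part will do, and otherwise any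
    bound will. *)
Lemma bounded_opP A : bounded_op A <->
  linear A /\ exists2 M : R, 0 <= M & forall x, rnorm (A x) <= M * rnorm x.
Proof.
split=> -[linA].
- move=> [M AM]; split=> //; exists `|complex.Re M| => // x.
  have := AM x; rewrite !norm_rnorm lecE => /andP[_].
  have -> : complex.Re (M * (rnorm x)%:C) = complex.Re M * rnorm x.
    by case: M {AM} => u v /=; rewrite mulr0 subr0.
  by move=> /le_trans; apply; rewrite ler_wpM2r ?rnorm_ge0 ?ler_norm.
- move=> [M _ AM]; split=> //; exists M%:C => x.
  by rewrite !norm_rnorm -rmorphM lecR.
Qed.

Lemma linopD A x y : linear A -> A (x + y) = A x + A y.
Proof. by move=> linA; have := linA 1 x y; rewrite !scale1r. Qed.

Lemma linop0 A : linear A -> A 0 = 0.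
Proof.
by move=> linA; apply: (addrI (A 0)); rewrite -(linopD 0 0 linA) !addr0.
Qed.

Lemma linopZ A a x : linear A -> A (a *: x) = a *: A x.
Proof. by move=> linA; have := linA a x 0; rewrite (linop0 linA) !addr0. Qed.

Lemma linop_lincomb A (d : nat) (l : 'I_d -> R[i]) (v : 'I_d -> H) : linear A ->
  A (\sum_k l k *: v k) = \sum_k l k *: A (v k).
Proof.
move=> linA; elim/big_ind2 : _ => [|x1 x2 y1 y2 <- <-|k _].
- exact: linop0.
- exact: linopD.
- exact: linopZ.
Qed.

Lemma bounded_op0 : bounded_op (0 : H -> H).
Proof.
apply/bounded_opP; split; first by move=> a x y; rewrite /= scaler0 addr0.
by exists 0 => // x; rewrite rnorm0 mul0r.
Qed.

(** The unit sphere of the zero space is empty, with supremum [0] by convention;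
    hence the condition [0 <= M]. *)
Lemma op_norm_le A (M : R) :
  0 <= M -> (forall x, rnorm (A x) <= M * rnorm x) -> op_norm A <= M.
Proof.
move=> M0 AM; rewrite /op_norm; set S := (X in sup X).
have [->|/set0P S0] := eqVneq S set0; first by rewrite sup0.
by apply: ge_sup => // _ [x x1 <-]; rewrite (le_trans (AM x))// x1 mulr1.
Qed.

Lemma rnorm_unit x : x != 0 -> rnorm ((rnorm x)^-1%:C *: x) = 1.
Proof.
move=> x0; rewrite rnormZr ger0_norm ?invr_ge0 ?rnorm_ge0// mulVf//.
by apply: contra_neq x0 => /rnorm_eq0.
Qed.

Lemma rnorm_gt0 x : x != 0 -> 0 < rnorm x.
Proof.
by move=> x0; rewrite lt_neqAle rnorm_ge0 andbT; apply: contra_neq x0 => /esym/rnorm_eq0.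
Qed.

Lemma op_normP A x : bounded_op A -> rnorm (A x) <= op_norm A * rnorm x.
Proof.
move=> /bounded_opP[linA [M M0 AM]].
have [->|x0] := eqVneq x 0; first by rewrite (linop0 linA) rnorm0 mulr0.
have xp := rnorm_gt0 x0.
rewrite -ler_pdivrMr// mulrC.
have -> : (rnorm x)^-1 * rnorm (A x) = rnorm (A ((rnorm x)^-1%:C *: x)).
  by rewrite (linopZ _ _ linA) rnormZr ger0_norm// invr_ge0 rnorm_ge0.
apply: ub_le_sup; last by exists ((rnorm x)^-1%:C *: x) => //=; exact: rnorm_unit.
by exists M => _ [y y1 <-]; rewrite (le_trans (AM y))// y1 mulr1.
Qed.

Lemma op_norm_ge0 A : bounded_op A -> 0 <= op_norm A.
Proof.
move=> bA; have [[x x0]|nx] := pselect (exists x : H, x != 0).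
  have := op_normP x bA; move/(le_trans (rnorm_ge0 _)).
  by rewrite pmulr_lge0// rnorm_gt0.
rewrite /op_norm; set S := (X in sup X).
suff -> : S = set0 by rewrite sup0.
apply/seteqP; split=> // t [x x1 _]; apply: nx; exists x.
by apply: contra_eq_neq x1 => ->; rewrite rnorm0 eq_sym oner_eq0.
Qed.

Lemma bounded_comp A B : bounded_op A -> bounded_op B -> bounded_op (A \o B).
Proof.
move=> /bounded_opP[lA [M M0 AM]] /bounded_opP[lB [N N0 BN]].
apply/bounded_opP; split.
  by move=> a x y /=; rewrite lB lA.
exists (M * N) => [|x /=]; first exact: mulr_ge0.
by rewrite (le_trans (AM _))// -mulrA ler_wpM2l.
Qed.

Lemma bounded_add A B : bounded_op A -> bounded_op B -> bounded_op (A \+ B).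
Proof.
move=> /bounded_opP[lA [M M0 AM]] /bounded_opP[lB [N N0 BN]].
apply/bounded_opP; split.
  by move=> a x y /=; rewrite lB lA scalerDr !addrA (addrAC (a *: A x)).
exists (M + N) => [|x /=]; first exact: addr_ge0.
by rewrite (le_trans (rnormD _ _))// mulrDl lerD.
Qed.

Lemma bounded_scale a A : bounded_op A -> bounded_op (a \*: A).
Proof.
move=> /bounded_opP[lA [M M0 AM]].
apply/bounded_opP; split.
  by move=> b x y /=; rewrite lA scalerDr !scalerA (mulrC a).
exists (complex.Re `|a| * M) => [|x /=].
  by rewrite mulr_ge0// Re_norm_ge0.
by rewrite rnormZ -mulrA ler_wpM2l// Re_norm_ge0.
Qed.

Lemma op_normZ_ge (c : R) A : 0 <= c -> bounded_op A ->
  c * op_norm A <= op_norm (c%:C \*: A).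
Proof.
rewrite le_eqVlt => /predU1P[<-|c0] bA.
  by rewrite mul0r; exact: op_norm_ge0 (bounded_scale _ bA).
have bcA := bounded_scale c%:C bA.
rewrite mulrC -ler_pdivlMr//; apply: op_norm_le => [|x].
  by rewrite divr_ge0 ?op_norm_ge0 ?(ltW c0).
rewrite mulrAC ler_pdivlMr// (le_trans _ (op_normP x bcA))//=.
by rewrite rnormZr gtr0_norm// mulrC.
Qed.

End OperatorNorm.

Section TupleNorms.
Local Open Scope complex_scope.
Context {R : realType} {H : completeNormedModType R[i]} {d : nat}.
Implicit Types (T : 'I_d -> H -> H) (l : 'I_d -> R[i]) (x : H).

Lemma rnorm_sum l (v : 'I_d -> H) :
  rnorm (\sum_k l k *: v k) <= \sum_k complex.Re `|l k| * rnorm (v k).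
Proof.
elim/big_ind2 : _ => [|x1 x2 y1 y2 h1 h2|k _]; first by rewrite rnorm0.
  exact: (le_trans (rnormD _ _) (lerD h1 h2)).
by rewrite rnormZ.
Qed.

Lemma unit_ball_real l :
  \sum_k `|l k| ^+ 2 <= 1 -> \sum_k (complex.Re `|l k|) ^+ 2 <= 1.
Proof.
move=> l1; rewrite -lecR rmorph_sum/=; apply: le_trans l1.
by apply: ler_sum => k _; rewrite -[X in _ <= X ^+ 2]RRe_real ?normr_real// rmorphXn.
Qed.

Lemma bounded_lincomb l T :
  (forall k, bounded_op (T k)) -> bounded_op (\sum_k l k \*: T k).
Proof.
move=> bT; elim/big_ind : _ => [|A B bA bB|k _].
- exact: bounded_op0.
- exact: bounded_add.
- exact: bounded_scale.
Qed.

Lemma lincombE l T x : (\sum_k l k \*: T k) x = \sum_k l k *: T k x.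
Proof. by rewrite fct_sumE. Qed.

Lemma hypo_norm_le T (M : R) : 0 <= M ->
  (forall l, \sum_k `|l k| ^+ 2 <= 1 ->
     forall x, rnorm (\sum_k l k *: T k x) <= M * rnorm x) ->
  hypo_norm T <= M.
Proof.
move=> M0 TM; apply: ge_sup.
  exists (op_norm (\sum_(k < d) (0:R[i]) \*: T k)), (fun=> 0) => //=.
  by rewrite big1// => k _; rewrite normr0 expr0n.
move=> _ [l /= l1 <-]; apply: op_norm_le => // x.
by rewrite lincombE TM.
Qed.

Lemma hypo_normP T l : (forall k, bounded_op (T k)) ->
  \sum_k `|l k| ^+ 2 <= 1 -> op_norm (\sum_k l k \*: T k) <= hypo_norm T.
Proof.
move=> bT l1; apply: ub_le_sup; last by exists l.
(* The family of norms is bounded because every [`|m k|] is at most [1]. *)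
exists (\sum_k op_norm (T k)) => _ [m /= /unit_ball_real m1 <-].
have T0 k : 0 <= op_norm (T k) by exact: op_norm_ge0.
apply: op_norm_le => [|x]; first exact: sumr_ge0.
rewrite lincombE (le_trans (rnorm_sum _ _))// mulr_suml.
apply: ler_sum => k _; apply: (@le_trans _ _ (rnorm (T k x))); last exact: op_normP.
apply: ler_piMl; first exact: rnorm_ge0.
have : complex.Re `|m k| ^+ 2 <= 1.
  apply: le_trans m1; rewrite (bigD1 k)//= lerDl.
  by apply: sumr_ge0 => j _; exact: sqr_ge0.
by rewrite expr_le1// Re_norm_ge0.
Qed.

Lemma hypo_norm_ge0 T : (forall k, bounded_op (T k)) -> 0 <= hypo_norm T.
Proof.
move=> bT; have bl := bounded_lincomb (fun=> 0) bT.
apply: le_trans (op_norm_ge0 bl) (hypo_normP bT _).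
by rewrite big1// => k _; rewrite normr0 expr0n.
Qed.

Lemma rnorm_lincomb_le T l x : (forall k, bounded_op (T k)) ->
  \sum_k `|l k| ^+ 2 <= 1 ->
  rnorm (\sum_k l k *: T k x) <= hypo_norm T * rnorm x.
Proof.
move=> bT l1; rewrite -lincombE.
rewrite (le_trans (op_normP x (bounded_lincomb l bT)))//.
by rewrite ler_wpM2r ?rnorm_ge0// hypo_normP.
Qed.

Lemma rnorm_lincomb_le_sqrt l (v : 'I_d -> H) : \sum_k `|l k| ^+ 2 <= 1 ->
  rnorm (\sum_k l k *: v k) <= sqrtr (\sum_k rnorm (v k) ^+ 2).
Proof.
move=> /unit_ball_real l1; apply: le_trans (rnorm_sum _ _) _.
exact: sum_mul_le_sqrt.
Qed.

Lemma joint_normP T x : (forall k, bounded_op (T k)) ->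
  sqrtr (\sum_k rnorm (T k x) ^+ 2) <= joint_norm T * rnorm x.
Proof.
move=> bT; have [->|x0] := eqVneq x 0.
  rewrite rnorm0 mulr0 big1 ?sqrtr0// => k _.
  by have /bounded_opP[lT _] := bT k; rewrite (linop0 lT) rnorm0 expr0n.
have xp := rnorm_gt0 x0.
rewrite -ler_pdivrMr//.
have -> : sqrtr (\sum_k rnorm (T k x) ^+ 2) / rnorm x =
    sqrtr (\sum_k rnorm (T k ((rnorm x)^-1%:C *: x)) ^+ 2).
  have -> : \sum_k rnorm (T k ((rnorm x)^-1%:C *: x)) ^+ 2 =
            (rnorm x)^-1 ^+ 2 * \sum_k rnorm (T k x) ^+ 2.
    rewrite mulr_sumr; apply: eq_bigr => k _.
    have /bounded_opP[lT _] := bT k; rewrite (linopZ _ _ lT) rnormZr exprMn.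
    by rewrite real_normK// num_real.
  by rewrite sqrtrM ?sqr_ge0// sqrtr_sqr ger0_norm ?invr_ge0 ?rnorm_ge0// mulrC.
apply: ub_le_sup; last by exists ((rnorm x)^-1%:C *: x) => //=; exact: rnorm_unit.
exists (sqrtr (\sum_k op_norm (T k) ^+ 2)) => _ [y /= y1 <-].
rewrite ler_wsqrtr//; apply: ler_sum => k _.
rewrite ler_pXn2r ?nnegrE ?rnorm_ge0 ?op_norm_ge0//.
by have := op_normP y (bT k); rewrite y1 mulr1.
Qed.

Lemma joint_norm_ge0 T : 0 <= joint_norm T.
Proof.
rewrite /joint_norm; set S := (X in sup X).
have [hS|nS] := pselect (has_sup S); last by rewrite sup_out.
have [[s Ss] ubS] := hS; apply: le_trans (ub_le_sup ubS Ss).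
by have [x _ <-] := Ss; exact: sqrtr_ge0.
Qed.

Lemma hypo_norm_le_joint T : (forall k, bounded_op (T k)) ->
  hypo_norm T <= joint_norm T.
Proof.
move=> bT; apply: hypo_norm_le (joint_norm_ge0 T) _ => l l1 x.
exact: le_trans (rnorm_lincomb_le_sqrt _ l1) (joint_normP x bT).
Qed.

End TupleNorms.

(** * Riesz representation and adjoints *)

Section Riesz.
Local Open Scope complex_scope.
Local Open Scope classical_set_scope.
Context {R : realType} {H : completeNormedModType R[i]}.
Context (dot : {dot H for (@conjC R[i])}) (hdot : norm_of_dot dot).
Implicit Types (A B : H -> H) (x y z u v : H).
Local Notation rdot := (rdot dot).

Lemma quadratic_ge0_eq0 (a b : R) : 0 <= b ->
  (forall t, 0 <= 2 * t * a + t ^+ 2 * b) -> a = 0.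
Proof.
move=> b0 /(_ (- a / (b + 1))).
have -> : 2 * (- a / (b + 1)) * a + (- a / (b + 1)) ^+ 2 * b =
  - (a ^+ 2 * ((b + 2) / (b + 1) ^+ 2)) by field; lra.
rewrite oppr_ge0 pmulr_lle0; last by rewrite divr_gt0 ?exprn_gt0//; lra.
by move=> a0; apply/eqP; rewrite -sqrf_eq0 eq_le a0 sqr_ge0.
Qed.

(** The representing vector is the minimizer of [phi x = |x|^2 - 2 f x].  By the
    parallelogram law a minimizing sequence is Cauchy, and the first variation
    of [phi] at the limit [z] is [2 (Re <z, y> - f y)], which has to vanish. *)
Theorem Riesz_real (f : H -> R) (M : R) :
  (forall x y, f (x + y) = f x + f y) ->
  (forall c x, f (c%:C *: x) = c * f x) ->
  (forall x, `|f x| <= M * rnorm x) ->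
  exists z, forall x, f x = rdot x z.
Proof.
move=> fD fZ fM.
pose phi x := rnorm x ^+ 2 - 2 * f x.
pose m := inf (range phi).
have phi_lb : has_lbound (range phi).
  exists (- M ^+ 2) => _ [x _ <-]; rewrite /phi.
  have := le_trans (ler_norm _) (fM x).
  have := sqr_ge0 (rnorm x - M); rewrite sqrrB; lra.
have phi_inf : has_inf (range phi) by split=> //; exists (phi 0), 0.
have m_le x : m <= phi x by apply: ge_inf => //; exists x.
have phiD x y (t : R) : phi (x + t%:C *: y) =
    phi x + 2 * t * (rdot x y - f y) + t ^+ 2 * rnorm y ^+ 2.
  rewrite /phi (rnormD_sqr hdot) rdotZr fD fZ rnormZr exprMn real_normK ?num_real//.
  by ring.
have parallelogram x y :
    rnorm (x - y) ^+ 2 <= 2 * (phi x - m) + 2 * (phi y - m).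
  (* [phi] is at least [m] at the midpoint. *)
  have := m_le (2^-1%:C *: (x + y)); rewrite /phi fZ fD rnormZr exprMn.
  rewrite real_normK ?num_real// !(rnormD_sqr hdot) rdotNr.
  have -> : rnorm (- y) = rnorm y by rewrite /rnorm normrN.
  lra.
have phi_approx n : exists x, phi x < m + n.+1%:R^-1.
  have [|_ [x _ <-] xm] := @inf_adherent _ (range phi) n.+1%:R^-1 _ phi_inf.
    by rewrite invr_gt0.
  by exists x.
have [u u_phi] := choice phi_approx.
have u_cvg : cvg (u @ \oo).
  apply: cauchy_cvg; apply: cauchy_exP => e e0.
  have ree : e = (complex.Re e)%:C by rewrite RRe_real// gtr0_real.
  have re0 : 0 < complex.Re e by rewrite -ltcR -ree.
  have [N _ HN] : \forall n \near \oo, n.+1%:R^-1 < complex.Re e ^+ 2 / 4.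
    by apply: (@near_infty_natSinv_lt R (PosNum _)); rewrite divr_gt0 ?exprn_gt0.
  exists (u N), N => // n /= Nn.
  rewrite -ball_normE /= norm_rnorm ree ltcR -(@ltr_pXn2r _ 2) ?nnegrE ?rnorm_ge0 ?ltW//.
  apply: (le_lt_trans (parallelogram _ _)).
  have := u_phi N; have := u_phi n.
  have := HN N (leqnn N); have := HN n Nn; move=> /=.
  by move: (n.+1%:R^-1) (N.+1%:R^-1) => a b; lra.
have /cvg_ex[z uz] := u_cvg.
have z_approx (e : R) : 0 < e -> exists2 x, phi x < m + e & rnorm (z - x) < e.
  move=> e0.
  have near_z : \forall n \near \oo, ball z e%:C (u n).
    by apply: (cvg_ball uz); rewrite ltcR.
  have small : \forall n \near \oo, n.+1%:R^-1 < e.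
    exact: (@near_infty_natSinv_lt R (PosNum e0)).
  have [n [zn en]] := filter_ex (filterI near_z small).
  exists (u n); first by rewrite (lt_trans (u_phi n))// ltrD2l.
  by move: zn; rewrite -ball_normE /= norm_rnorm ltcR.
exists z => y.
suff : rdot z y - f y = 0 by move/subr0_eq => <-; exact: rdotC.
apply: (@quadratic_ge0_eq0 _ (rnorm y ^+ 2)); first exact: sqr_ge0.
move=> t; apply/ler_addgt0Pl => d d0; rewrite ?addr0.
(* [d / K] is a precision at which all the error terms add up to [d]. *)
pose K := 1 + 2 * `|t| * rnorm y.
have K0 : 0 < K by rewrite ltr_pwDl// !mulr_ge0 ?rnorm_ge0.
have [x xm xz] := z_approx (d / K) (divr_gt0 d0 K0).
have := m_le (x + t%:C *: y); rewrite phiD.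
have -> : rdot x y = rdot z y - rdot (z - x) y by rewrite rdotDl rdotNl; ring.
have : `|t * rdot (z - x) y| <= `|t| * (d / K * rnorm y).
  rewrite normrM ler_wpM2l// (le_trans (CauchySchwarz_rdot hdot _ _))//.
  by rewrite ler_wpM2r ?rnorm_ge0// ltW.
have : d = d / K + 2 * (`|t| * (d / K * rnorm y)).
  have -> : d / K + 2 * (`|t| * (d / K * rnorm y)) = d / K * K by rewrite /K; ring.
  by rewrite divfK// gt_eqF.
have := ler_norm (t * rdot (z - x) y); have := ler_norm (- (t * rdot (z - x) y)).
by rewrite normrN; lra.
Qed.

Lemma dot_ext u v : (forall x, dot x u = dot x v) -> u = v.
Proof.
move=> uv; apply/eqP; rewrite -subr_eq0 -(dnorm_eq0 dot).
by rewrite linearBr /= uv subrr.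
Qed.

(** Imaginary parts are real parts at ['i *: x], and [A] is complex linear. *)
Lemma rdot_adjointP A B : linear A ->
  (forall x y, rdot (A x) y = rdot x (B y)) ->
  forall x y, dot (A x) y = dot x (B y).
Proof.
move=> lA AB x y; apply/eqP; rewrite eq_complex; apply/andP; split; apply/eqP.
  exact: AB.
by apply: oppr_inj; rewrite -!rdotil -AB (linopZ _ _ lA).
Qed.

(** [||B y||^2 = Re <A (B y), y> <= M ||B y|| ||y||]. *)
Lemma rdot_adjoint_le A B (M : R) :
  (forall x y, rdot (A x) y = rdot x (B y)) -> 0 <= M ->
  (forall x, rnorm (A x) <= M * rnorm x) ->
  forall y, rnorm (B y) <= M * rnorm y.
Proof.
move=> AB M0 AM y.
have [By0|/rnorm_gt0 By0] := eqVneq (B y) 0.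
  by rewrite By0 rnorm0 mulr_ge0 ?rnorm_ge0.
rewrite -(ler_pM2l By0) -expr2 -(rdotxx hdot) -AB.
rewrite (le_trans (le_trans (ler_norm _) (CauchySchwarz_rdot hdot _ _)))//.
by rewrite mulrA (mulrC _ M) ler_wpM2r ?rnorm_ge0.
Qed.

Theorem adjoint_exists A : bounded_op A ->
  exists B, bounded_op B /\ forall x y, dot (A x) y = dot x (B y).
Proof.
move=> /bounded_opP[lA [M M0 AM]].
have ex y : exists z, forall x, rdot (A x) y = rdot x z.
  apply: (@Riesz_real _ (M * rnorm y)) => [x x'|c x|x].
  - by rewrite (linopD _ _ lA) rdotDl.
  - by rewrite (linopZ _ _ lA) rdotZl.
  - rewrite (le_trans (CauchySchwarz_rdot hdot _ _))// mulrAC.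
    by rewrite ler_wpM2r ?rnorm_ge0.
have [B AB] := choice ex.
have dAB : forall x y, dot (A x) y = dot x (B y).
  by apply: rdot_adjointP => // x y; exact: AB.
exists B; split=> //; apply/bounded_opP; split.
  move=> a y y'; apply: dot_ext => x.
  by rewrite -dAB !linearDr /= !dotZr -!dAB.
by exists M => //; apply: rdot_adjoint_le M0 AM => x y; exact: AB.
Qed.

Lemma adjointP A : bounded_op A ->
  bounded_op (adjoint dot A) /\ forall x y, dot (A x) y = dot x (adjoint dot A y).
Proof. by move=> /adjoint_exists exA; exact: (xgetPex 0 exA). Qed.

Lemma rdot_adjoint A x y : bounded_op A ->
  rdot (A x) y = rdot x (adjoint dot A y).
Proof. by move=> /adjointP[_ h]; rewrite /rdot h. Qed.

End Riesz.

(** * The arithmetic-geometric mean inequality for operators *)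

Section ArithmeticGeometricMean.
Local Open Scope complex_scope.
Context {R : realType} {H : completeNormedModType R[i]}.
Context (dot : {dot H for (@conjC R[i])}) (hdot : norm_of_dot dot).
Implicit Types (A B X Y : H -> H) (x y z u v : H).
Local Notation rdot := (rdot dot).

Definition self_adjoint A := forall x y, rdot (A x) y = rdot x (A y).

(** Put [b = ||B||] and [v = B u / b], where [||B u|| > b - eta].  Since
    [||v|| <= 1], [||B^* v - b u||^2 <= b^2 - 2 ||B u||^2 + b^2 <= 4 b eta]. *)
Lemma approx_singular_vector B (e : R) : bounded_op B -> 0 < op_norm B -> 0 < e ->
  exists u, [/\ rnorm u = 1, op_norm B / 2 <= rnorm (B u) &
    rnorm (adjoint dot B ((op_norm B)^-1%:C *: B u) - (op_norm B)%:C *: u) <= e].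
Proof.
move=> bB; set b := op_norm B => b0 e0.
pose eta := Num.min (b / 2) (e ^+ 2 / (4 * b)).
have eta0 : 0 < eta by rewrite lt_min divr_gt0 //= divr_gt0 ?exprn_gt0 ?mulr_gt0.
have [||_ [u u1 <-] Bu] := @sup_adherent _
  [set rnorm (B x) | x in [set x | rnorm x = 1]]%classic eta.
- exact: eta0.
- apply: contrapT => nS; move: b0; rewrite /b /op_norm sup_out ?ltxx//.
rewrite -/(op_norm B) -/b in Bu.
have etab : eta <= b / 2 by rewrite ge_min lexx.
have etae : 4 * b * eta <= e ^+ 2.
  by rewrite -ler_pdivlMl ?mulr_gt0// mulrC ge_min lexx orbT.
exists u; split => //; first lra.
set v := b^-1%:C *: B u; set w := adjoint dot B v.
have Bub : rnorm (B u) <= b by have := op_normP u bB; rewrite u1 mulr1.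
have v1 : rnorm v <= 1.
  by rewrite rnormZr normfV gtr0_norm// mulrC ler_pdivrMr// mul1r.
have wb : rnorm w <= b.
  have /(_ v) := rdot_adjoint_le hdot (fun x y => rdot_adjoint hdot x y bB)
    (ltW b0) (fun x => op_normP x bB).
  by move=> /le_trans; apply; rewrite ler_piMr// (ltW b0).
have wu : rdot w u = rnorm (B u) ^+ 2 / b.
  by rewrite rdotC -(rdot_adjoint hdot)// rdotZr (rdotxx hdot) mulrC.
rewrite -(@ler_pXn2r _ 2) ?nnegrE ?rnorm_ge0 ?(ltW e0)//.
rewrite (rnormD_sqr hdot) rdotNr rdotZr wu.
have -> : rnorm (- (b%:C *: u)) = b.
  by rewrite /rnorm normrN -/(rnorm _) rnormZr u1 mulr1 gtr0_norm.
rewrite mulrN [b * _]mulrC divfK ?gt_eqF//.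
apply: le_trans etae.
have : rnorm w ^+ 2 <= b ^+ 2 by rewrite ler_pXn2r ?nnegrE ?rnorm_ge0 ?(ltW b0).
have : (b - eta) ^+ 2 <= rnorm (B u) ^+ 2.
  by rewrite ler_pXn2r ?nnegrE ?rnorm_ge0//; lra.
have := sqr_ge0 eta; rewrite sqrrB; lra.
Qed.

(** Argue by contradiction with [b = ||X A Y|| > N / 2], [N] the norm on the
    right.  For [u], [v], [w = Y u], [z = X v] as in [approx_singular_vector]
    and [s = ||w||^2 + ||z||^2], testing the operator on the right against
    [w] and [z] gives [(b - N / 2) s <= ||Y||^2 e], while
    [b / 2 <= ||A|| s] keeps [s] away from [0]; this is impossible for [e]
    small. *)
Theorem op_norm_agm X Y A :
  bounded_op X -> bounded_op Y -> bounded_op A ->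
  self_adjoint X -> self_adjoint Y ->
  2 * op_norm (X \o A \o Y) <= op_norm ((X \o X \o A) \+ (A \o Y \o Y)).
Proof.
move=> bX bY bA sX sY; set B := X \o A \o Y; set S := _ \+ _.
have bB : bounded_op B by exact: bounded_comp (bounded_comp bX bA) bY.
have bS : bounded_op S.
  apply: bounded_add; first exact: bounded_comp (bounded_comp bX bX) bA.
  exact: bounded_comp (bounded_comp bA bY) bY.
have lX : linear X by case: bX.
have lY : linear Y by case: bY.
have lA : linear A by case: bA.
set b := op_norm B; set N := op_norm S.
have N0 : 0 <= N by exact: op_norm_ge0.
rewrite leNgt; apply/negP => Nb.
have b0 : 0 < b by lra.
pose a := op_norm A; pose q := op_norm Y.
have a0 : 0 <= a by exact: op_norm_ge0.
have q0 : 0 <= q by exact: op_norm_ge0.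
(* The two estimates yield [c <= a q^2 e], which this [e] contradicts. *)
pose c := (b - N / 2) * (b / 2).
have c0 : 0 < c by rewrite mulr_gt0 ?divr_gt0//; lra.
pose e := c / (a * q ^+ 2 + 1).
have aq0 : 0 < a * q ^+ 2 + 1 by rewrite ltr_wpDl// mulr_ge0 ?sqr_ge0.
have e0 : 0 < e by rewrite divr_gt0.
have [u [u1 Bu due]] := approx_singular_vector bB b0 e0.
rewrite -/b in Bu due.
set v := b^-1%:C *: B u in due; set d := (X in rnorm X <= e) in due.
pose w := Y u; pose z := X v.
have Bub : B u = b%:C *: v by rewrite scalerA -rmorphM divff ?gt_eqF// scale1r.
have wq : rnorm w <= q by have := op_normP u bY; rewrite u1 mulr1.
have Swz : rdot (S w) z = b * (rnorm z ^+ 2 + rnorm w ^+ 2) + rdot (Y w) d.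
  have -> : S w = X (B u) + A (Y (Y w)) by [].
  rewrite rdotDl Bub (linopZ _ _ lX) rdotZl (rdotxx hdot) /z -sX.
  have -> : rdot (X (A (Y (Y w)))) v = rdot (Y w) (b%:C *: u + d).
    by rewrite (rdot_adjoint hdot (A := B))// /d [_ + (_ - _)]addrC subrK.
  by rewrite rdotDr rdotZr sY (rdotxx hdot) -/w; ring.
have Awz : rnorm (B u) ^+ 2 / b = rdot (A w) z.
  by rewrite -sX -(rdotxx hdot) mulrC -rdotZr.
have wz : rnorm w * rnorm z <= (rnorm w ^+ 2 + rnorm z ^+ 2) / 2.
  have := sqr_ge0 (rnorm w - rnorm z); rewrite sqrrB; lra.
set s := rnorm w ^+ 2 + rnorm z ^+ 2 in wz.
have s0 : 0 <= s by rewrite addr_ge0 ?sqr_ge0.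
have bas : b / 2 <= a * s.
  have : b / 4 <= rnorm (B u) ^+ 2 / b.
    rewrite ler_pdivlMr//.
    have -> : b / 4 * b = (b / 2) ^+ 2 by field.
    by rewrite ler_pXn2r ?nnegrE ?rnorm_ge0// divr_ge0 ?(ltW b0).
  have : rdot (A w) z <= a * (s / 2).
    rewrite (le_trans (le_trans (ler_norm _) (CauchySchwarz_rdot hdot _ _)))//.
    apply: (@le_trans _ _ (a * (rnorm w * rnorm z))); last exact: ler_wpM2l.
    by rewrite mulrA ler_wpM2r ?rnorm_ge0 ?op_normP.
  by rewrite Awz; lra.
have upper : (b - N / 2) * s <= q ^+ 2 * e.
  have : rdot (S w) z <= N * (s / 2).
    rewrite (le_trans (le_trans (ler_norm _) (CauchySchwarz_rdot hdot _ _)))//.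
    apply: (@le_trans _ _ (N * (rnorm w * rnorm z))); last exact: ler_wpM2l.
    by rewrite mulrA ler_wpM2r ?rnorm_ge0 ?op_normP.
  have : - rdot (Y w) d <= q ^+ 2 * e.
    rewrite (le_trans (ler_norm _))// normrN.
    rewrite (le_trans (CauchySchwarz_rdot hdot _ _))//.
    apply: ler_pM; rewrite ?rnorm_ge0//.
    by rewrite (le_trans (op_normP _ bY))// expr2 ler_wpM2l.
  by rewrite Swz -/s [_ ^+ 2 + _]addrC -/s; lra.
have : c <= a * (q ^+ 2 * e).
  apply: (@le_trans _ _ ((b - N / 2) * (a * s))); first by rewrite ler_wpM2l//; lra.
  by rewrite mulrCA ler_wpM2l.
have : c = (a * q ^+ 2 + 1) * e by rewrite mulrC divfK ?gt_eqF.
by lra.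
Qed.

(** [op_norm_agm] at [X = sqrt (1 - l) Q] and [Y = sqrt l Q]. *)
Lemma weighted_agm Q A (l : R) : 0 <= l <= 1 ->
  bounded_op Q -> self_adjoint Q -> bounded_op A ->
  2 * sqrtr (l - l ^+ 2) * op_norm (Q \o A \o Q) <=
    op_norm (l%:C \*: (A \o Q \o Q) \+ (1 - l)%:C \*: (Q \o Q \o A)).
Proof.
move=> /andP[l0 l1] bQ sQ bA.
have [lQ _] := bQ; have [lA _] := bA.
pose X := (sqrtr (1 - l))%:C \*: Q; pose Y := (sqrtr l)%:C \*: Q.
have saZ (c : R) : self_adjoint (c%:C \*: Q).
  by move=> x y /=; rewrite rdotZl rdotZr sQ.
have := op_norm_agm (bounded_scale _ bQ : bounded_op X)
  (bounded_scale _ bQ : bounded_op Y) bA (saZ _) (saZ _).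
have -> : (X \o X \o A) \+ (A \o Y \o Y) =
    l%:C \*: (A \o Q \o Q) \+ (1 - l)%:C \*: (Q \o Q \o A).
  apply/funext => x; rewrite /X /Y /=.
  rewrite !(linopZ _ _ lQ) !(linopZ _ _ lA) !scalerA -!rmorphM -!expr2.
  by rewrite !sqr_sqrtr ?subr_ge0// addrC.
apply: le_trans; rewrite -mulrA ler_wpM2l//.
have -> : sqrtr (l - l ^+ 2) = sqrtr (1 - l) * sqrtr l.
  by rewrite -sqrtrM ?subr_ge0//; congr sqrtr; ring.
have -> : (sqrtr (1 - l))%:C \*: Q \o A \o ((sqrtr l)%:C \*: Q) =
    (sqrtr (1 - l) * sqrtr l)%:C \*: (Q \o A \o Q).
  by apply/funext => x /=; rewrite (linopZ _ _ lA) (linopZ _ _ lQ) scalerA rmorphM.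
apply: op_normZ_ge; first by rewrite mulr_ge0 ?sqrtr_ge0.
exact: bounded_comp (bounded_comp bQ bA) bQ.
Qed.

(** Positivity says in particular that [<A x, x>] is real.  Polarize
    [Im <A x, x> = 0], then replace [y] by ['i y]. *)
Lemma positive_self_adjoint A : linear A -> positive_op dot A -> self_adjoint A.
Proof.
move=> lA pA.
have Im0 x : rdot ('i *: A x) x = 0.
  by rewrite rdotil; have := pA x; rewrite lecE => /andP[/eqP /= -> _]; rewrite oppr0.
have polar x y : rdot ('i *: A x) y + rdot ('i *: A y) x = 0.
  have := Im0 (x + y); rewrite (linopD _ _ lA) scalerDr rdotDl !rdotDr.
  by rewrite !Im0 addr0 add0r.
move=> x y; have := polar x ('i *: y).
rewrite (linopZ _ _ lA) scalerA -expr2 sqr_i scaleN1r rdotNl.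
have -> : rdot ('i *: A x) ('i *: y) = rdot (A x) y.
  by rewrite /rdot dotZl dotZr; case: (dot _ _) => p q /=; ring.
by move/subr0_eq; rewrite (rdotC _ x).
Qed.

End ArithmeticGeometricMean.

(** * The spherical polar decomposition and the transforms *)

Section PolarDecomposition.
Local Open Scope complex_scope.
Context {R : realType} {H : completeNormedModType R[i]}.
Context (dot : {dot H for (@conjC R[i])}) (hdot : norm_of_dot dot).
Implicit Types (A : H -> H) (x : H).
Local Notation rdot := (rdot dot).

(** The second alternative is the default value of the selection; it also
    satisfies the other two properties, so that they hold unconditionally. *)
Lemma sqrt_opP A :
  [/\ bounded_op (sqrt_op dot A), self_adjoint dot (sqrt_op dot A) &
      sqrt_op dot A \o sqrt_op dot A = A \/ sqrt_op dot A = 0].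
Proof.
rewrite /sqrt_op; case: xgetP => [B _ [bB pB BA]|_].
  split=> //; last by left.
  by apply: positive_self_adjoint => //; case: bB.
split; last by right.
  exact: bounded_op0.
by move=> x y; rewrite /rdot linear0l linear0r.
Qed.

Context {d : nat} (T : 'I_d -> H -> H) (bT : forall k, bounded_op (T k)).
Local Notation P := (polar_modulus dot T).
Local Notation Q := (sqrt_op dot P).
Local Notation V := (polar_factor dot T).

(** [||P x||^2 = <P^2 x, x> = sum_k ||T_k x||^2]. *)
Lemma polar_modulus_le x : rnorm (P x) <= joint_norm T * rnorm x.
Proof.
rewrite /polar_modulus; set S := \sum_k _.
have [bP sP [PP|->]] := sqrt_opP S; last first.
  by rewrite rnorm0 mulr_ge0 ?rnorm_ge0 ?joint_norm_ge0.
apply: le_trans (joint_normP x bT).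
rewrite -[leLHS]ger0_norm ?rnorm_ge0// -sqrtr_sqr ler_wsqrtr//.
rewrite -(rdotxx hdot) sP.
have -> : sqrt_op dot S (sqrt_op dot S x) = S x by rewrite -[in RHS]PP.
rewrite /S fct_sumE /rdot linear_sumr raddf_sum/=.
apply: ler_sum => k _; rewrite -/(rdot _ _) -(rdot_adjoint hdot)//.
by rewrite (rdotxx hdot).
Qed.

(** The sum [E] of the [V_k^* V_k] being an orthogonal projection,
    [sum_k ||V_k x||^2 = Re <x, E x> = ||E x||^2 <= ||x|| ||E x||]. As for the
    square root, the last alternative is the default value of the selection. *)
Lemma polar_factorP :
  [/\ forall k, bounded_op (V k),
      forall x, \sum_k rnorm (V k x) ^+ 2 <= rnorm x ^+ 2 &
      (forall k, T k = V k \o P) \/ V = fun=> 0].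
Proof.
rewrite /polar_factor; case: xgetP => [W _ [bW TW projW]|_]; last first.
  split; last by right.
    by move=> k; exact: bounded_op0.
  by move=> x; rewrite big1 ?sqr_ge0// => k _; rewrite rnorm0 expr0n.
split => // [x|]; last by left.
set E := \sum_k _ in projW.
have [ME xE] := projW x.
have sumE : \sum_k rnorm (W k x) ^+ 2 = rdot x (E x).
  rewrite /E fct_sumE /rdot linear_sumr raddf_sum/=.
  apply: eq_bigr => k _; rewrite -/(rdot _ _) -(rdot_adjoint hdot)//.
  by rewrite (rdotxx hdot).
have rdot_Ex : rdot x (E x) = rnorm (E x) ^+ 2.
  rewrite -(rdotxx hdot); apply/eqP; rewrite -subr_eq0 -rdotNl -rdotDl.
  by rewrite /rdot xE.
rewrite sumE rdot_Ex ler_pXn2r ?nnegrE ?rnorm_ge0//.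
have [->|/rnorm_gt0 Ex0] := eqVneq (E x) 0; first by rewrite rnorm0 rnorm_ge0.
rewrite -(ler_pM2r Ex0) -expr2 -rdot_Ex.
exact: le_trans (ler_norm _) (CauchySchwarz_rdot hdot _ _).
Qed.

Lemma bounded_polar_modulus : bounded_op P.
Proof. by have [] := sqrt_opP (\sum_k (adjoint dot (T k) \o T k)). Qed.

Lemma bounded_duggal k : bounded_op (duggal dot T k).
Proof.
have [bV _ _] := polar_factorP.
exact: bounded_comp bounded_polar_modulus (bV k).
Qed.

Lemma bounded_lambda_mean (l : R) k : bounded_op (lambda_mean dot l T k).
Proof.
by apply: bounded_add; apply: bounded_scale; [exact: bT | exact: bounded_duggal].
Qed.

(** A combination of the [P V_k] is [P A], and [||A x|| <= ||x||]. *)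
Lemma hypo_norm_duggal_le : hypo_norm (duggal dot T) <= joint_norm T.
Proof.
have [bV Vle _] := polar_factorP.
have linP : linear P by case: bounded_polar_modulus.
apply: hypo_norm_le (joint_norm_ge0 T) _ => l l1 x.
have -> : \sum_k l k *: duggal dot T k x = P (\sum_k l k *: V k x).
  by rewrite (linop_lincomb _ _ linP).
apply: le_trans (polar_modulus_le _) _; rewrite ler_wpM2l ?joint_norm_ge0//.
apply: le_trans (rnorm_lincomb_le_sqrt _ l1) _.
by rewrite -[leRHS]ger0_norm ?rnorm_ge0// -sqrtr_sqr ler_wsqrtr.
Qed.

Lemma hypo_norm_lambda_mean_le (l : R) : 0 <= l <= 1 ->
  hypo_norm (lambda_mean dot l T) <=
    l * hypo_norm T + (1 - l) * hypo_norm (duggal dot T).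
Proof.
move=> /andP[l0 l1].
have hT := hypo_norm_ge0 bT; have hD := hypo_norm_ge0 bounded_duggal.
apply: hypo_norm_le => [|m m1 x]; first by rewrite addr_ge0// mulr_ge0// subr_ge0.
have -> : \sum_k m k *: lambda_mean dot l T k x =
    l%:C *: (\sum_k m k *: T k x) + (1 - l)%:C *: (\sum_k m k *: duggal dot T k x).
  rewrite !scaler_sumr -big_split/=; apply: eq_bigr => k _.
  by rewrite scalerDr !scalerA ![m k * _]mulrC.
rewrite (le_trans (rnormD _ _))// !rnormZr !ger0_norm ?subr_ge0//.
rewrite [leRHS]mulrDl -!mulrA; apply: lerD; apply: ler_wpM2l; rewrite ?subr_ge0//.
  exact: rnorm_lincomb_le.
by apply: rnorm_lincomb_le => //; exact: bounded_duggal.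
Qed.

(** If [Q] or [V] is the default value [0], the Aluthge transform vanishes.
    Otherwise [Q^2 = P] and [T_k = V_k P], and [weighted_agm] applies
    to each combination [A] of the [V_k]. *)
Lemma hypo_norm_aluthge_le (l : R) : 0 <= l <= 1 ->
  2 * sqrtr (l - l ^+ 2) * hypo_norm (aluthge dot T) <=
    hypo_norm (lambda_mean dot l T).
Proof.
move=> l01; have hM := hypo_norm_ge0 (bounded_lambda_mean l).
have [bQ sQ QQ] := sqrt_opP P.
have [bV _ TV] := polar_factorP.
have linQ : linear Q by case: bQ.
have aluthge0 : (forall k x, aluthge dot T k x = 0) ->
    2 * sqrtr (l - l ^+ 2) * hypo_norm (aluthge dot T) <=
    hypo_norm (lambda_mean dot l T).
  move=> A0; apply: le_trans hM; rewrite mulr_ge0_le0 ?mulr_ge0 ?sqrtr_ge0//.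
  apply: hypo_norm_le => // m _ x.
  by rewrite big1 ?rnorm0 ?mul0r// => k _; rewrite A0 scaler0.
case: QQ => [QQ|Q0]; last by apply: aluthge0 => k x; rewrite /aluthge Q0.
case: TV => [TV|V0]; last first.
  by apply: aluthge0 => k x; rewrite /aluthge V0 /= (linop0 linQ).
set c := 2 * _.
have : 0 <= c by rewrite mulr_ge0 ?sqrtr_ge0.
rewrite le_eqVlt => /predU1P[<-|c0]; first by rewrite mul0r.
rewrite mulrC -ler_pdivlMr//; apply: hypo_norm_le => [|m m1 x].
  by rewrite divr_ge0 ?(ltW c0).
pose A := \sum_k m k \*: V k.
have bA : bounded_op A by exact: bounded_lincomb.
have -> : \sum_k m k *: aluthge dot T k x = (Q \o A \o Q) x.
  by rewrite /= /A lincombE (linop_lincomb _ _ linQ).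
rewrite (le_trans (op_normP x (bounded_comp (bounded_comp bQ bA) bQ)))//.
rewrite ler_wpM2r ?rnorm_ge0// ler_pdivlMr// mulrC.
apply: le_trans (weighted_agm hdot l01 bQ sQ bA) _.
suff -> : l%:C \*: (A \o Q \o Q) \+ (1 - l)%:C \*: (Q \o Q \o A) =
    \sum_k m k \*: lambda_mean dot l T k.
  by apply: hypo_normP => // k; exact: bounded_lambda_mean.
apply/funext => y; rewrite lincombE /=.
have linP : linear P by case: bounded_polar_modulus.
rewrite -[Q (Q y)]/((Q \o Q) y) -[Q (Q (A y))]/((Q \o Q) (A y)) QQ /A !lincombE.
rewrite (linop_lincomb _ _ linP) !scaler_sumr -big_split/=; apply: eq_bigr => k _.
have Tk : T k y = V k (P y) by rewrite {1}TV.
by rewrite /lambda_mean /= Tk scalerDr !scalerA ![m k * _]mulrC.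
Qed.

End PolarDecomposition.

(** * The inequalities *)

Theorem theorem2p3 (R : realType) (H : completeNormedModType R[i])
    (dot : {dot H for (@conjC R[i])}) (hdot : norm_of_dot dot)
    (hsep : separable_space H)
    (d : nat) (T : 'I_d -> H -> H) (hT : forall k, bounded_op (T k)) :
  (forall l : R, 0 <= l <= 1 ->
     [/\ 2 * sqrtr (l - l ^+ 2) * hypo_norm (aluthge dot T)
           <= hypo_norm (lambda_mean dot l T),
         hypo_norm (lambda_mean dot l T)
           <= l * hypo_norm T + (1 - l) * hypo_norm (duggal dot T) &
         l * hypo_norm T + (1 - l) * hypo_norm (duggal dot T)
           <= joint_norm T]) /\
  (hypo_norm (aluthge dot T) <= hypo_norm (mean_transform dot T) /\
   hypo_norm (mean_transform dot T) <= joint_norm T).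
Proof.
have lmean (l : R) : 0 <= l <= 1 ->
     [/\ 2 * sqrtr (l - l ^+ 2) * hypo_norm (aluthge dot T)
           <= hypo_norm (lambda_mean dot l T),
         hypo_norm (lambda_mean dot l T)
           <= l * hypo_norm T + (1 - l) * hypo_norm (duggal dot T) &
         l * hypo_norm T + (1 - l) * hypo_norm (duggal dot T)
           <= joint_norm T].
  move=> l01; have /andP[l0 l1] := l01; split.
  - exact: hypo_norm_aluthge_le.
  - exact: hypo_norm_lambda_mean_le.
  - rewrite [leRHS](_ : _ = l * joint_norm T + (1 - l) * joint_norm T); last by ring.
    apply: lerD; apply: ler_wpM2l; rewrite ?subr_ge0//.
      exact: hypo_norm_le_joint.
    exact: hypo_norm_duggal_le.
split => //.
have half01 : 0 <= (2^-1 : R) <= 1 by apply/andP; split; lra.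
have [+ le2 le3] := lmean 2^-1 half01.
have -> : mean_transform dot T = lambda_mean dot 2^-1 T.
  apply/funext => k; apply/funext => x.
  rewrite /mean_transform /lambda_mean /= scalerDr.
  have -> : 1 - 2^-1 = 2^-1 :> R by field.
  by rewrite fmorphV rmorph_nat.
have -> : 2^-1 - 2^-1 ^+ 2 = 2^-1 ^+ 2 :> R by field.
rewrite sqrtr_sqr ger0_norm ?invr_ge0// divff// mul1r => le1.
by split => //; exact: le_trans le2 le3.
Qed.
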